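(* Let $z_0 \in \mathbb{C}$ and let the harmonic mapping $$f(z) = h(z) + \overline{g(z)} = \sum_{k=1}^\infty a_k (z-z_0)^k + \overline{\sum_{k=1}^\infty b_k (z-z_0)^k}$$ (both power series with complex coefficients, converging in a disk around $z_0$) have a singular zero at $z_0$ with $|a_1| = |b_1| \neq 0$. Let $\theta \in [0, \pi)$ be defined by $\overline{b_1} = a_1 e^{i 2\theta}$, and let $$f_{\delta c}(z) = f(z) - \delta c, \quad \text{with} \quad c = \overline{b_1}\, e^{-i\theta}\, \widetilde{c} \quad \text{and} \quad \widetilde{c} = - \frac{a_2}{a_1} e^{i\theta} - \overline{\left( \frac{b_2}{b_1} e^{i\theta} \right)},$$ where $\delta$ is real. 1. If $\operatorname{Im}(\widetilde{c}) \neq 0$, then for sufficiently small $\delta > 0$ the function $f_{\delta c}$ has two distinct zeros close to $z_0$. These zeros are the limits of the harmonic Newton iteration for $f_{\delta c}$ with the initial points $$z_\pm = z_0 \pm i \sqrt{\delta}\, e^{i\theta}$$ (which can also be written $z_0 \pm i\sqrt{\delta\, \overline{b_1}/a_1}$, with the square root of $\overline{b_1}/a_1$ taken to be $e^{i\theta}$). Precisely: for every $\varepsilon > 0$ there is $\delta_0 > 0$ such that for all $0 < \delta < \delta_0$ the harmonic Newton iterations for $f_{\delta c}$ started at $z_+$ and at $z_-$ are well defined and converge to two distinct zeros of $f_{\delta c}$, both in $\{|z - z_0| < \varepsilon\}$. 2. If $\operatorname{Im}(\widetilde{c}) = 0$ and $|a_2| \neq |b_2|$, then for real $\delta \neq 0$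 with sufficiently small $|\delta|$, the harmonic Newton iteration for $f_{\delta c}$ with initial point $$z_3 = z_0 + \frac{1 - \sqrt{1 - \delta \widetilde{c}^{\,2}}}{\widetilde{c}}\, e^{i\theta}$$ converges to a zero of $f_{\delta c}$.
   Context: A harmonic mapping $f = h + \overline{g}$ ($h, g$ analytic on an open set $\Omega\subseteq\mathbb{C}$) has Jacobian $J_f(z) = |h'(z)|^2 - |g'(z)|^2$. A zero $z_0$ of $f$ is called singular if $J_f(z_0) = 0$. For a function $F = H + \overline{G}$ with $H, G$ analytic on $\Omega$, the harmonic Newton iteration with initial point $\zeta_0 \in \Omega$ is $$\zeta_{k+1} = \zeta_k - \frac{\overline{H'(\zeta_k)}\, F(\zeta_k) - \overline{G'(\zeta_k)\, F(\zeta_k)}}{|H'(\zeta_k)|^2 - |G'(\zeta_k)|^2}, \qquad k \ge 0.$$ It is well defined if every iterate lies in $\Omega$ and satisfies $|H'(\zeta_k)|^2 \neq |G'(\zeta_k)|^2$. For $F = f_{\delta c}$ one takes $H = h - \delta c$ and $G = g$, so $H' = h'$ and $G' = g'$. Convergence of the iteration includes that it is well defined. In part 2, $\widetilde c$ is real and nonzero under the stated hypotheses, and for small $|\delta|$ the square root is the positive square root of the positive real number $1 - \delta\widetilde{c}^{\,2}$. *)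

(* Defs.v *)
From Stdlib Require Export Reals.
From Coquelicot Require Export Coquelicot.

Open Scope C_scope.

(** [exp (i t)] for real [t]. *)
Definition expi (t : R) : C := (cos t, sin t).

Definition disk (z0 : C) (r : R) (z : C) : Prop := (Cmod (z - z0) < r)%R.

Definition power_series_on_disk (a : nat -> C) (z0 : C) (r : R) (h : C -> C)
  : Prop :=
  forall z : C, disk z0 r z ->
    @is_pseries C_AbsRing C_NormedModule a (z - z0) (h z).

(** A harmonic mapping [H + conj G] is represented by the pair [H], [G]
    of its analytic and co-analytic parts. *)
Definition harmonic (H G : C -> C) (z : C) : C := H z + Cconj (G z).

(** [C_derive] is total and takes its limit along the real direction only;
    it agrees with the complex derivative wherever the latter exists
    ([is_C_derive_unique]), in particular inside the disk of convergence of a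
    power series. *)
Definition jacobian (H G : C -> C) (z : C) : R :=
  (Cmod (C_derive H z) ^ 2 - Cmod (C_derive G z) ^ 2)%R.

(** The functions are total in Rocq, so the domain [Omega] on which they are
    meant has to be carried along explicitly. *)
Definition is_zero (Omega : C -> Prop) (H G : C -> C) (z : C) : Prop :=
  Omega z /\ harmonic H G z = 0.

Definition singular_zero (Omega : C -> Prop) (H G : C -> C) (z : C) : Prop :=
  is_zero Omega H G z /\ jacobian H G z = 0%R.

Definition newton_step (H G : C -> C) (z : C) : C :=
  z - (Cconj (C_derive H z) * harmonic H G z
       - Cconj (C_derive G z * harmonic H G z)) / RtoC (jacobian H G z).

Fixpoint newton_iter (H G : C -> C) (zeta0 : C) (k : nat) : C :=
  match k with
  | O => zeta0
  | S k' => newton_step H G (newton_iter H G zeta0 k')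
  end.

Definition newton_well_defined (Omega : C -> Prop) (H G : C -> C) (zeta0 : C)
  : Prop :=
  forall k : nat,
    Omega (newton_iter H G zeta0 k) /\
    (Cmod (C_derive H (newton_iter H G zeta0 k)) ^ 2 <>
     Cmod (C_derive G (newton_iter H G zeta0 k)) ^ 2)%R.

Definition newton_converges (Omega : C -> Prop) (H G : C -> C) (zeta0 w : C)
  : Prop :=
  newton_well_defined Omega H G zeta0 /\
  filterlim (newton_iter H G zeta0) eventually (locally w).

(** The analytic part of [f - delta * c]; its co-analytic part is that of
    [f]. *)
Definition shifted (h : C -> C) (delta : R) (c : C) (z : C) : C :=
  h z - RtoC delta * c.

(* Main.v *)
Require Import Defs.
From Stdlib Require Import Psatz.

(** Rotating and rescaling by [z = z0 + u exp(i theta)] and dividing by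
    [a1 exp(i theta)] makes the two linear parts of [f] equal to [u] and
    [conj u]. With [A = (a2 / a1) exp(i theta)] and [B = (b2 / b1) exp(i theta)]
    one has [ctilde = - A - conj B], and the equation [f = delta c] becomes
    [2 Re u + A u^2 + conj (B u^2) + O(u^3) = delta ctilde], while the Jacobian
    is [4 |a1|^2 Re ((A - B) u) + O(u^2)].

    The initial points of the theorem are exact roots of the quadratic
    truncation. For [u = +- i sqrt delta] the linear term vanishes and
    [u^2 = - delta]. For real [ctilde] and real [u] the truncation is
    [2 u - ctilde u^2 = delta ctilde], whose small root is
    [(1 - sqrt (1 - delta ctilde^2)) / ctilde]. At such a point the residual of
    [f - delta c] is therefore [O(|u|^3)]. The Jacobian, although it tends to 0,
    is at least a constant times [|u|]: along imaginary [u] its leading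
    coefficient is, up to sign, [Im (A - B) = - Im ctilde], and along real [u] it is
    [Re (A - B)], which is nonzero because [|A|^2 - |B|^2] is
    [- ctilde Re (A - B)] when [Im A = Im B].

    A residual of order [s^3] against a Jacobian of order [s] gives a first
    Newton step of order [s^2]. That is short compared with [s], so the Jacobian
    keeps its size along the whole iteration and the usual Newton-Kantorovich
    induction goes through ([newton_converges_near]); the limit is a zero within
    [O(s^2)] of the start. In the first case, where the two starting points are
    [2 sqrt delta] apart, this also separates the two zeros. The reduction to the
    normal form is [newton_converges_normal_form], and the analytic input
    (Taylor remainders for power series and their derivatives, uniformly on a
    small disk) is [power_series_expansion]. *)

(** * Complex moduli and dominated series *)

Lemma Cmod_minus_sym (x y : C) : Cmod (x - y) = Cmod (y - x).
Proof. rewrite <- Cmod_opp. f_equal. ring. Qed.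

Lemma Cmod_minus_le (x y z : C) :
  (Cmod (x - z) <= Cmod (x - y) + Cmod (y - z))%R.
Proof.
  replace (x - z) with ((x - y) + (y - z)) by ring. apply Cmod_triangle.
Qed.

Lemma Cmod_triangle_minus (x y : C) : (Cmod (x - y) <= Cmod x + Cmod y)%R.
Proof. rewrite <- (Cmod_opp y). apply Cmod_triangle. Qed.

Lemma Cmod_triangle_inv (x y : C) : (Rabs (Cmod x - Cmod y) <= Cmod (x - y))%R.
Proof.
  pose proof (Cmod_triangle (x - y) y) as Hx.
  pose proof (Cmod_triangle (y - x) x) as Hy.
  replace (x - y + y) with x in Hx by ring.
  replace (y - x + x) with y in Hy by ring.
  rewrite Cmod_minus_sym in Hy. apply Rabs_le. lra.
Qed.

Lemma sum_half_pow_le (B : R) (n : nat) :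
  (0 <= B)%R -> (sum_n (fun k => B * (1 / 2) ^ k) n <= 2 * B)%R.
Proof.
  intros HB.
  assert (H : (sum_n (fun k => B * (1 / 2) ^ k) n = 2 * B - B * (1 / 2) ^ n)%R).
  { induction n as [|n IH].
    - rewrite sum_O. simpl. lra.
    - rewrite sum_Sn, IH. unfold plus. simpl. lra. }
  rewrite H. pose proof (pow_lt (1 / 2) n ltac:(lra)). nra.
Qed.

Lemma ex_series_geometric (u : nat -> C) (B : R) :
  (forall n, (Cmod (u n) <= B * (1 / 2) ^ n)%R) ->
  exists l : C, @is_series C_AbsRing C_NormedModule u l.
Proof.
  intros Hu.
  destruct (@ex_series_le C_AbsRing C_CompleteNormedModule u
              (fun n => B * (1 / 2) ^ n)%R) as [l Hl].
  - intros n. apply Hu.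
  - apply (@ex_series_scal_l R_AbsRing R_NormedModule B). apply ex_series_geom.
    rewrite Rabs_pos_eq; lra.
  - exists l. exact Hl.
Qed.

Lemma Cmod_filterlim (u : nat -> C) (l : C) :
  filterlim u eventually (locally l) ->
  is_lim_seq (fun n => Cmod (u n)) (Cmod l).
Proof.
  intros Hu. unfold is_lim_seq.
  apply (filterlim_comp _ _ _ u Cmod eventually (locally l)); [exact Hu|].
  exact (@filterlim_norm C_AbsRing C_NormedModule l).
Qed.

Lemma Cmod_series_le (u : nat -> C) (l : C) (B : R) :
  @is_series C_AbsRing C_NormedModule u l ->
  (forall n, (Cmod (u n) <= B * (1 / 2) ^ n)%R) ->
  (Cmod l <= 2 * B)%R.
Proof.
  intros Hl Hu.
  assert (HB : (0 <= B)%R).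
  { pose proof (Hu 0%nat) as H. simpl in H. pose proof (Cmod_ge_0 (u 0%nat)). lra. }
  apply (is_lim_seq_le
           (fun n => Cmod (@sum_n C_NormedModule u n)) (fun _ => (2 * B)%R)
           (Cmod l) (2 * B)%R).
  - intros n. eapply Rle_trans; [|apply (sum_half_pow_le B n HB)].
    eapply Rle_trans.
    + apply (@norm_sum_n_m C_AbsRing C_NormedModule u 0 n).
    + apply sum_n_m_le. exact Hu.
  - apply Cmod_filterlim. exact Hl.
  - apply is_lim_seq_const.
Qed.

(** * Taylor remainders of power series *)

Lemma pow_n_Cpow (x : C) (n : nat) : @pow_n C_Ring x n = x ^ n.
Proof.
  induction n as [|n IH]; [reflexivity|].
  simpl pow_n. rewrite IH. reflexivity.
Qed.

Lemma power_series_is_series (a : nat -> C) (z0 : C) (r : R) (h : C -> C) (z : C) :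
  power_series_on_disk a z0 r h -> disk z0 r z ->
  @is_series C_AbsRing C_NormedModule (fun k => a k * (z - z0) ^ k) (h z).
Proof.
  intros Hh Hz. eapply is_series_ext; [|exact (Hh z Hz)].
  intros n. change (@pow_n C_Ring (z - z0) n * a n = a n * (z - z0) ^ n).
  rewrite pow_n_Cpow. ring.
Qed.

(** The terms at one point of the disk at distance [q] from the centre form a
    convergent series, so they are bounded; this is all that is used of the
    convergence of the series. *)
Lemma power_series_coef_bound (a : nat -> C) (z0 : C) (r : R) (h : C -> C) (q : R) :
  (0 < q < r)%R -> power_series_on_disk a z0 r h ->
  exists M : R, (0 < M)%R /\ forall k, (Cmod (a k) * q ^ k <= M)%R.
Proof.
  intros Hq Hh.
  assert (Hz : disk z0 r (z0 + RtoC q)).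
  { unfold disk. replace (z0 + RtoC q - z0) with (RtoC q) by ring.
    rewrite Cmod_R, Rabs_pos_eq; lra. }
  pose proof (power_series_is_series a z0 r h _ Hh Hz) as Hs.
  destruct (@filterlim_bounded C_AbsRing C_NormedModule _ (ex_intro _ _ Hs))
    as [M HM].
  set (u := fun k => a k * (z0 + RtoC q - z0) ^ k) in *.
  change (forall n, (Cmod (@sum_n C_NormedModule u n) <= M)%R) in HM.
  (* a term is the difference of two consecutive partial sums *)
  assert (Hu : forall k, (Cmod (u k) <= 2 * M)%R).
  { pose proof (HM 0%nat) as HM0. rewrite sum_O in HM0.
    pose proof (Cmod_ge_0 (u 0%nat)).
    intros [|k]; [lra|].
    pose proof (HM k) as H1. pose proof (HM (S k)) as H2. rewrite sum_Sn in H2.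
    replace (u (S k)) with (plus (@sum_n C_NormedModule u k) (u (S k))
                            - @sum_n C_NormedModule u k).
    2:{ change (@sum_n C_NormedModule u k + u (S k) - @sum_n C_NormedModule u k
                = u (S k)). ring. }
    eapply Rle_trans; [apply Cmod_triangle_minus|]. lra. }
  exists (Rmax (2 * M) 1). split; [pose proof (Rmax_r (2 * M) 1); lra|].
  intros k. eapply Rle_trans; [|apply Rmax_l].
  eapply Rle_trans; [|exact (Hu k)]. unfold u.
  replace (z0 + RtoC q - z0) with (RtoC q) by ring.
  rewrite Cmod_mult, Cmod_pow, Cmod_R, Rabs_pos_eq; lra.
Qed.

(** Makes series in which [a n] multiplies some polynomial dominated by the
    geometric series of ratio 1/2: it suffices that the polynomials grow at
    most like the powers of [q / 2], half of the radius for which the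
    coefficients are controlled. *)
Lemma coef_tail_bound (a : nat -> C) (q M e : R) (j k : nat) (T : C) :
  (0 < q)%R -> (Cmod (a (k + j)%nat) * q ^ (k + j) <= M)%R ->
  (Cmod T <= (q / 2) ^ k * e)%R ->
  (Cmod (a (k + j)%nat * T) <= M / q ^ j * e * (1 / 2) ^ k)%R.
Proof.
  intros Hq Ha HT. rewrite Cmod_mult.
  assert (Hqk := pow_lt q k Hq). assert (Hqj := pow_lt q j Hq).
  assert (H2k := pow_lt (1 / 2) k ltac:(lra)).
  replace (q / 2)%R with (q * (1 / 2))%R in HT by lra.
  rewrite Rpow_mult_distr in HT. rewrite pow_add in Ha.
  assert (He : (0 <= e)%R).
  { pose proof (Cmod_ge_0 T). assert (0 < q ^ k * (1 / 2) ^ k)%R by nra. nra. }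
  pose proof (Cmod_ge_0 (a (k + j)%nat)) as Ha0.
  apply Rle_trans with (Cmod (a (k + j)%nat) * (q ^ k * (1 / 2) ^ k * e))%R; [nra|].
  replace (Cmod (a (k + j)%nat) * (q ^ k * (1 / 2) ^ k * e))%R
    with ((Cmod (a (k + j)%nat) * (q ^ k * q ^ j)) / q ^ j * e * (1 / 2) ^ k)%R
    by (field; lra).
  apply Rmult_le_compat_r; [lra|]. apply Rmult_le_compat_r; [lra|].
  apply Rmult_le_compat_r; [|lra]. apply Rlt_le, Rinv_0_lt_compat, Hqj.
Qed.

Lemma is_series_tail (u : nat -> C) (l : C) :
  @is_series C_AbsRing C_NormedModule u l ->
  @is_series C_AbsRing C_NormedModule (fun k => u (k + 1)%nat) (l - u 0%nat).
Proof.
  intros H. apply is_series_ext with (fun k => u (S k)).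
  - intros n. f_equal. lia.
  - apply (@is_series_incr_1 C_AbsRing C_NormedModule u).
    change (@is_series C_AbsRing C_NormedModule u (l - u 0%nat + u 0%nat)).
    replace (l - u 0%nat + u 0%nat) with l by ring. exact H.
Qed.

Lemma is_series_tail2 (u : nat -> C) (l : C) :
  @is_series C_AbsRing C_NormedModule u l ->
  @is_series C_AbsRing C_NormedModule (fun k => u (k + 2)%nat)
    (l - u 0%nat - u 1%nat).
Proof.
  intros H. eapply is_series_ext; [|exact (is_series_tail _ _ (is_series_tail _ _ H))].
  intros n. simpl. f_equal. lia.
Qed.

Lemma is_series_tail3 (u : nat -> C) (l : C) :
  @is_series C_AbsRing C_NormedModule u l ->
  @is_series C_AbsRing C_NormedModule (fun k => u (k + 3)%nat)
    (l - u 0%nat - u 1%nat - u 2%nat).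
Proof.
  intros H. eapply is_series_ext; [|exact (is_series_tail _ _ (is_series_tail2 _ _ H))].
  intros n. simpl. f_equal. lia.
Qed.

Lemma INR_le_pow2 (k : nat) : (INR (k + 1) <= 2 ^ k)%R.
Proof.
  induction k as [|k IH]; [simpl; lra|].
  replace (S k + 1)%nat with (S (k + 1)) by lia. rewrite S_INR. simpl.
  pose proof (pow_R1_Rle 2 k ltac:(lra)). lra.
Qed.

(** Induction on [k]: passing from one exponent to the next multiplies the
    remainder by [y] and adds [(k + 2) x^(k+1) (y - x)^2]. The sharp constant is
    the binomial coefficient [k + 2] over [2]; the cruder [3 ^ k] is absorbed by
    the geometric decay of the coefficients on a small enough disk. *)
Lemma Cpow_remainder (x y : C) (p : R) (k : nat) :
  (Cmod x <= p)%R -> (Cmod y <= p)%R ->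
  (Cmod (y ^ (k + 2) - x ^ (k + 2) - RtoC (INR (k + 2)) * x ^ (k + 1) * (y - x))
     <= (3 * p) ^ k * Cmod (y - x) ^ 2)%R.
Proof.
  intros Hx Hy.
  assert (Hp : (0 <= p)%R) by (pose proof (Cmod_ge_0 x); lra).
  induction k as [|k IH].
  - simpl. rewrite Rmult_1_l, Rmult_1_r, <- Cmod_mult.
    right. f_equal. rewrite RtoC_plus. ring.
  - replace (S k + 2)%nat with (S (k + 2)) by lia.
    replace (S k + 1)%nat with (S (k + 1)) by lia.
    rewrite S_INR, RtoC_plus.
    set (P := y ^ (k + 2) - x ^ (k + 2)
              - RtoC (INR (k + 2)) * x ^ (k + 1) * (y - x)) in *.
    replace (y ^ S (k + 2) - x ^ S (k + 2)
             - (RtoC (INR (k + 2)) + RtoC 1) * x ^ S (k + 1) * (y - x))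
      with (y * P + RtoC (INR (k + 2)) * x ^ (k + 1) * (y - x) * (y - x)).
    2:{ unfold P. replace (k + 2)%nat with (S (k + 1)) by lia. simpl. ring. }
    eapply Rle_trans; [apply Cmod_triangle|].
    rewrite !Cmod_mult, Cmod_pow, Cmod_R, (Rabs_pos_eq _ (pos_INR _)).
    assert (Hd := Cmod_ge_0 (y - x)). set (d := Cmod (y - x)) in *.
    assert (HpP : (Cmod y * Cmod P <= p * ((3 * p) ^ k * d ^ 2))%R).
    { apply Rmult_le_compat; auto using Cmod_ge_0. }
    assert (Hxk : (Cmod x ^ (k + 1) <= p ^ (k + 1))%R).
    { apply pow_incr. split; [apply Cmod_ge_0|exact Hx]. }
    assert (HI : (INR (k + 2) <= 2 * 3 ^ k)%R).
    { clear. induction k as [|k IH]; [simpl; lra|].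
      replace (S k + 2)%nat with (S (k + 2)) by lia. rewrite S_INR. simpl.
      pose proof (pow_R1_Rle 3 k ltac:(lra)). lra. }
    assert (Hm : (INR (k + 2) * Cmod x ^ (k + 1) <= 2 * 3 ^ k * p ^ (k + 1))%R).
    { apply Rmult_le_compat; auto using pos_INR. apply pow_le, Cmod_ge_0. }
    rewrite Rpow_mult_distr in *. rewrite !pow_add, !pow_1 in *. simpl.
    simpl in HpP. set (t := (3 ^ k)%R) in *. set (v := (p ^ k)%R) in *.
    assert (0 <= d * d)%R by nra.
    assert (INR (k + 2) * (Cmod x ^ k * Cmod x) * (d * d)
            <= 2 * t * (v * p) * (d * d))%R by (apply Rmult_le_compat_r; [assumption|]; exact Hm).
    nra.
Qed.

Lemma Cpow_deriv_bound (x : C) (p : R) (k : nat) :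
  (Cmod x <= p)%R ->
  (Cmod (RtoC (INR (k + 1)) * x ^ k) <= (2 * p) ^ k)%R.
Proof.
  intros Hx. rewrite Cmod_mult, Cmod_pow, Cmod_R, (Rabs_pos_eq _ (pos_INR _)).
  rewrite Rpow_mult_distr.
  apply Rmult_le_compat; auto using pos_INR, INR_le_pow2.
  - apply pow_le, Cmod_ge_0.
  - apply pow_incr. split; [apply Cmod_ge_0|exact Hx].
Qed.

(** The form in which analyticity enters Newton's method. Since it is
    required at every pair of points, it also makes [C_derive f] Lipschitz. *)
Definition quadratic_remainder (z0 : C) (rho K : R) (f : C -> C) : Prop :=
  forall x y : C, disk z0 rho x -> disk z0 rho y ->
    (Cmod (f y - f x - C_derive f x * (y - x)) <= K * Cmod (y - x) ^ 2)%R.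

Lemma C_derive_of_remainder (z0 : C) (rho K : R) (f : C -> C) (x l : C) :
  disk z0 rho x ->
  (forall y, disk z0 rho y ->
     (Cmod (f y - f x - l * (y - x)) <= K * Cmod (y - x) ^ 2)%R) ->
  C_derive f x = l.
Proof.
  intros Hx Hrem. apply is_C_derive_unique. split.
  - apply (is_linear_scal_l (K := C_AbsRing) (V := C_NormedModule)).
  - intros x' Hx' eps.
    apply (is_filter_lim_locally_unique (V := AbsRing_NormedModule C_AbsRing)) in Hx'.
    subst x'. unfold disk in Hx.
    set (d := Rmin (rho - Cmod (x - z0)) (eps / (Rabs K + 1))).
    assert (HK : (0 < Rabs K + 1)%R) by (pose proof (Rabs_pos K); lra).
    assert (Hd : (0 < d)%R).
    { apply Rmin_pos; [lra|]. apply Rdiv_lt_0_compat; [apply cond_pos|lra]. }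
    exists (mkposreal d Hd). intros y Hy.
    assert (Hyx : (Cmod (y - x) < d)%R) by exact Hy. clear Hy.
    change (Cmod (f y - f x - (y - x) * l) <= eps * Cmod (y - x))%R.
    rewrite (Cmult_comm (y - x) l).
    assert (Hy : disk z0 rho y).
    { unfold disk. pose proof (Cmod_minus_le y x z0).
      pose proof (Rmin_l (rho - Cmod (x - z0)) (eps / (Rabs K + 1))).
      unfold d in Hyx. lra. }
    eapply Rle_trans; [apply Hrem, Hy|].
    pose proof (Cmod_ge_0 (y - x)) as H0.
    assert (HKd : (K * Cmod (y - x) <= eps)%R).
    { pose proof (Rmin_r (rho - Cmod (x - z0)) (eps / (Rabs K + 1))) as Hr.
      assert (Cmod (y - x) < eps / (Rabs K + 1))%R as H1 by (unfold d in Hyx; lra).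
      apply (Rmult_lt_compat_r _ _ _ HK) in H1.
      replace (eps / (Rabs K + 1) * (Rabs K + 1))%R with (pos eps) in H1
        by (field; lra).
      pose proof (Rle_abs K). nra. }
    simpl. nra.
Qed.

(** Each estimate is a termwise one, summed: the coefficients are bounded by
    [M / q^k] with [q = r / 2], and on the disk of radius [q / 8] the factors
    [2^k] and [3^k] coming from differentiation still leave a series dominated
    by powers of 1/2. The derivative is identified through its quadratic
    remainder. *)
Lemma power_series_expansion (a : nat -> C) (z0 : C) (r : R) (h : C -> C) :
  (0 < r)%R -> power_series_on_disk a z0 r h ->
  exists rho K : R,
    (0 < rho <= r)%R /\ (0 < K)%R /\
    quadratic_remainder z0 rho K h /\
    (forall w : C, (Cmod w < rho)%R ->
       (Cmod (h (z0 + w)%C - (a 0%nat + a 1%nat * w + a 2%nat * w ^ 2))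
          <= K * Cmod w ^ 3)%R /\
       (Cmod (C_derive h (z0 + w)%C - (a 1%nat + 2 * a 2%nat * w))
          <= K * Cmod w ^ 2)%R).
Proof.
  intros Hr Hh.
  set (q := (r / 2)%R). set (rho := (q / 8)%R).
  destruct (power_series_coef_bound a z0 r h q) as [M [HM Ha]];
    [unfold q; lra|exact Hh|].
  assert (Hq : (0 < q)%R) by (unfold q; lra).
  assert (Hser : forall x, disk z0 rho x ->
    @is_series C_AbsRing C_NormedModule (fun k => a k * (x - z0) ^ k) (h x)).
  { intros x Hx. apply (power_series_is_series a z0 r h x Hh).
    unfold disk, rho, q in *. lra. }
  (* the termwise derivative; [pred] is harmless because of the factor [k] *)
  set (du := fun (x : C) k => a k * (RtoC (INR k) * (x - z0) ^ Init.Nat.pred k)).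
  assert (Hder : forall x, disk z0 rho x ->
    exists l, @is_series C_AbsRing C_NormedModule (du x) l).
  { intros x Hx.
    destruct (ex_series_geometric (fun k => du x (k + 1)%nat) (M / q ^ 1 * 1))
      as [l Hl].
    - intros n. apply coef_tail_bound; [exact Hq|apply Ha|].
      rewrite Rmult_1_r. replace (Init.Nat.pred (n + 1)) with n by lia.
      eapply Rle_trans; [apply (Cpow_deriv_bound _ rho)|].
      + unfold disk in Hx. lra.
      + apply pow_incr. unfold rho. lra.
    - exists (l + du x 0%nat).
      apply (@is_series_decr_1 C_AbsRing C_NormedModule).
      change (@is_series C_AbsRing C_NormedModule (fun k => du x (S k))
                (l + du x 0%nat - du x 0%nat)).
      replace (l + du x 0%nat - du x 0%nat) with l by ring.
      eapply is_series_ext; [|exact Hl]. intros n. simpl. f_equal. lia. }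
  set (K := (2 * (M / q ^ 2) + 2 * (M / q ^ 3) * 3)%R).
  assert (HM2 : (0 < M / q ^ 2)%R) by (apply Rdiv_lt_0_compat; [lra|apply pow_lt, Hq]).
  assert (HM3 : (0 < M / q ^ 3)%R) by (apply Rdiv_lt_0_compat; [lra|apply pow_lt, Hq]).
  assert (Hrem : forall x l, disk z0 rho x ->
    @is_series C_AbsRing C_NormedModule (du x) l ->
    forall y, disk z0 rho y ->
    (Cmod (h y - h x - l * (y - x)) <= K * Cmod (y - x) ^ 2)%R).
  { intros x l Hx Hl y Hy.
    set (u := fun k => a k * ((y - z0) ^ k - (x - z0) ^ k
                - RtoC (INR k) * (x - z0) ^ Init.Nat.pred k * (y - x))).
    assert (Hu : @is_series C_AbsRing C_NormedModule u (h y - h x - l * (y - x))).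
    { pose proof (is_series_minus _ _ _ _
                    (is_series_minus _ _ _ _ (Hser y Hy) (Hser x Hx))
                    (is_series_scal_l (y - x) _ _ Hl)) as Hs.
      replace (h y - h x - l * (y - x)) with (h y - h x - (y - x) * l) by ring.
      eapply is_series_ext; [|exact Hs].
      intros n. change (a n * (y - z0) ^ n - a n * (x - z0) ^ n
                        - (y - x) * du x n = u n).
      unfold u, du. ring. }
    pose proof (is_series_tail2 _ _ Hu) as Ht.
    assert (Hu01 : h y - h x - l * (y - x) - u 0%nat - u 1%nat
                   = h y - h x - l * (y - x)).
    { unfold u. simpl. ring. }
    rewrite Hu01 in Ht. eapply Rle_trans; [apply (Cmod_series_le _ _
      (M / q ^ 2 * Cmod (y - x) ^ 2) Ht)|].
    - intros n. unfold u. apply coef_tail_bound; [exact Hq|apply Ha|].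
      replace (Init.Nat.pred (n + 2)) with (n + 1)%nat by lia.
      replace (y - x) with ((y - z0) - (x - z0)) by ring.
      eapply Rle_trans; [apply (Cpow_remainder _ _ rho)|];
        [unfold disk in *; lra | unfold disk in *; lra|].
      apply Rmult_le_compat_r; [apply pow2_ge_0|].
      apply pow_incr. unfold rho. lra.
    - pose proof (pow2_ge_0 (Cmod (y - x))). unfold K. nra. }
  assert (Hd : forall x, disk z0 rho x ->
    @is_series C_AbsRing C_NormedModule (du x) (C_derive h x)).
  { intros x Hx. destruct (Hder x Hx) as [l Hl].
    rewrite (C_derive_of_remainder z0 rho K h x l Hx (Hrem x l Hx Hl)). exact Hl. }
  exists rho, K. repeat split.
  - unfold rho; lra.
  - unfold rho, q; lra.
  - unfold K; lra.
  - intros x y Hx Hy. apply Hrem; auto.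
  - intros. 
    assert (Hx : disk z0 rho (z0 + w)).
    { unfold disk. replace (z0 + w - z0) with w by ring. exact H. }
    pose proof (is_series_tail3 _ _ (Hser _ Hx)) as Hs.
    replace (z0 + w - z0) with w in Hs by ring.
    replace (h (z0 + w)%C - (a 0%nat + a 1%nat * w + a 2%nat * w ^ 2))
      with (h (z0 + w)%C - a 0%nat * w ^ 0 - a 1%nat * w ^ 1 - a 2%nat * w ^ 2)
      by (simpl; ring).
    eapply Rle_trans; [apply (Cmod_series_le _ _ (M / q ^ 3 * Cmod w ^ 3) Hs)|].
    + intros n. apply coef_tail_bound; [exact Hq|apply Ha|].
      rewrite Cmod_pow, pow_add. 
      apply Rmult_le_compat_r; [apply pow_le, Cmod_ge_0|].
      apply pow_incr. split; [apply Cmod_ge_0|]. unfold rho in H. lra.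
    + pose proof (pow_le (Cmod w) 3 (Cmod_ge_0 w)). unfold K. nra.
  - assert (Hx : disk z0 rho (z0 + w)).
    { unfold disk. replace (z0 + w - z0) with w by ring. exact H. }
    pose proof (is_series_tail3 _ _ (Hd _ Hx)) as Hs. unfold du in Hs.
    replace (z0 + w - z0) with w in Hs by ring.
    replace (C_derive h (z0 + w) - (a 1%nat + 2 * a 2%nat * w))
      with (C_derive h (z0 + w) - a 0%nat * (RtoC (INR 0) * w ^ 0)
            - a 1%nat * (RtoC (INR 1) * w ^ 0) - a 2%nat * (RtoC (INR 2) * w ^ 1)).
    2:{ replace (INR 2) with 2%R by (simpl; ring). simpl. ring. }
    eapply Rle_trans; [apply (Cmod_series_le _ _ (M / q ^ 3 * (3 * Cmod w ^ 2)) Hs)|].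
    + intros n. apply coef_tail_bound; [exact Hq|apply Ha|].
      replace (Init.Nat.pred (n + 3)) with (n + 2)%nat by lia.
      rewrite Cpow_add_r, Cmult_assoc, Cmod_mult, Cmod_pow, <- Rmult_assoc.
      apply Rmult_le_compat_r; [apply pow_le, Cmod_ge_0|].
      rewrite Cmod_mult, Cmod_pow, Cmod_R, (Rabs_pos_eq _ (pos_INR _)).
      replace ((q / 2) ^ n * 3)%R with (3 * 2 ^ n * (2 * rho) ^ n)%R.
      2:{ replace (q / 2)%R with (2 * (2 * rho))%R by (unfold rho; lra).
          rewrite !Rpow_mult_distr. ring. }
      apply Rmult_le_compat; [apply pos_INR|apply pow_le, Cmod_ge_0| |].
      * pose proof (INR_le_pow2 n) as H2. pose proof (pow_R1_Rle 2 n ltac:(lra)).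
        rewrite plus_INR in *. simpl in *. lra.
      * apply pow_incr. pose proof (Cmod_ge_0 w). lra.
    + pose proof (pow2_ge_0 (Cmod w)). unfold K. nra.
Qed.

(** * Local convergence of the harmonic Newton iteration *)

Lemma quadratic_remainder_weaken (z0 : C) (rho rho' K K' : R) (f : C -> C) :
  (rho' <= rho)%R -> (K <= K')%R ->
  quadratic_remainder z0 rho K f -> quadratic_remainder z0 rho' K' f.
Proof.
  intros Hr HK H x y Hx Hy. unfold disk in *.
  eapply Rle_trans; [apply H; unfold disk; lra|].
  apply Rmult_le_compat_r; [apply pow2_ge_0|exact HK].
Qed.

Lemma C_derive_shifted (z0 : C) (rho K delta : R) (c x : C) (h : C -> C) :
  quadratic_remainder z0 rho K h -> disk z0 rho x ->
  C_derive (shifted h delta c) x = C_derive h x.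
Proof.
  intros Hh Hx. apply (C_derive_of_remainder z0 rho K _ x _ Hx). intros y Hy.
  unfold shifted.
  replace (h y - RtoC delta * c - (h x - RtoC delta * c) - C_derive h x * (y - x))
    with (h y - h x - C_derive h x * (y - x)) by ring.
  apply Hh; assumption.
Qed.

Lemma quadratic_remainder_shifted (z0 : C) (rho K delta : R) (c : C) (h : C -> C) :
  quadratic_remainder z0 rho K h ->
  quadratic_remainder z0 rho K (shifted h delta c).
Proof.
  intros Hh x y Hx Hy. rewrite (C_derive_shifted z0 rho K delta c x h Hh Hx).
  unfold shifted.
  replace (h y - RtoC delta * c - (h x - RtoC delta * c) - C_derive h x * (y - x))
    with (h y - h x - C_derive h x * (y - x)) by ring.
  apply Hh; assumption.
Qed.

(** Add the expansions of [f] from [x] to [y] and from [y] to [x]: the values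
    cancel and the difference of the derivatives remains. *)
Lemma C_derive_lipschitz (z0 : C) (rho K : R) (f : C -> C) (x y : C) :
  quadratic_remainder z0 rho K f -> disk z0 rho x -> disk z0 rho y ->
  (Cmod (C_derive f y - C_derive f x) <= 2 * K * Cmod (y - x))%R.
Proof.
  intros Hf Hx Hy.
  pose proof (Cmod_ge_0 (y - x)) as H0.
  destruct (Req_dec (Cmod (y - x)) 0) as [E|E].
  - apply Cmod_eq_0 in E. replace y with x.
    + replace (C_derive f x - C_derive f x) with (RtoC 0) by ring.
      replace (x - x) with (RtoC 0) by ring. rewrite Cmod_0. lra.
    + replace y with (y - x + x) by ring. rewrite E. ring.
  - apply (Rmult_le_reg_r (Cmod (y - x))); [lra|]. rewrite <- Cmod_mult.
    replace ((C_derive f y - C_derive f x) * (y - x))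
      with ((f y - f x - C_derive f x * (y - x))
            + (f x - f y - C_derive f y * (x - y))) by ring.
    eapply Rle_trans; [apply Cmod_triangle|].
    pose proof (Hf x y Hx Hy) as H1. pose proof (Hf y x Hy Hx) as H2.
    rewrite (Cmod_minus_sym x y) in H2. lra.
Qed.

Lemma jacobian_lipschitz (z0 : C) (rho K D : R) (H G : C -> C) (x y : C) :
  quadratic_remainder z0 rho K H -> quadratic_remainder z0 rho K G ->
  (forall z, disk z0 rho z -> (Cmod (C_derive H z) <= D)%R) ->
  (forall z, disk z0 rho z -> (Cmod (C_derive G z) <= D)%R) ->
  disk z0 rho x -> disk z0 rho y ->
  (Rabs (jacobian H G y - jacobian H G x) <= 8 * D * K * Cmod (y - x))%R.
Proof.
  intros HH HG DH DG Hx Hy.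
  assert (Hsq : forall f : C -> C, quadratic_remainder z0 rho K f ->
    (forall z, disk z0 rho z -> (Cmod (C_derive f z) <= D)%R) ->
    (Rabs (Cmod (C_derive f y) ^ 2 - Cmod (C_derive f x) ^ 2)
       <= 4 * D * K * Cmod (y - x))%R).
  { intros f Hf Df.
    replace (Cmod (C_derive f y) ^ 2 - Cmod (C_derive f x) ^ 2)%R
      with ((Cmod (C_derive f y) + Cmod (C_derive f x))
            * (Cmod (C_derive f y) - Cmod (C_derive f x)))%R by ring.
    pose proof (Df x Hx). pose proof (Df y Hy).
    pose proof (Cmod_ge_0 (C_derive f x)). pose proof (Cmod_ge_0 (C_derive f y)).
    rewrite Rabs_mult, Rabs_pos_eq by lra.
    replace (4 * D * K * Cmod (y - x))%R
      with ((2 * D) * (2 * K * Cmod (y - x)))%R by ring.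
    apply Rmult_le_compat; [lra|apply Rabs_pos|lra|].
    eapply Rle_trans; [apply Cmod_triangle_inv|].
    apply (C_derive_lipschitz z0 rho); assumption. }
  unfold jacobian.
  replace (Cmod (C_derive H y) ^ 2 - Cmod (C_derive G y) ^ 2
           - (Cmod (C_derive H x) ^ 2 - Cmod (C_derive G x) ^ 2))%R
    with ((Cmod (C_derive H y) ^ 2 - Cmod (C_derive H x) ^ 2)
          - (Cmod (C_derive G y) ^ 2 - Cmod (C_derive G x) ^ 2))%R by ring.
  pose proof (Hsq H HH DH). pose proof (Hsq G HG DG).
  eapply Rle_trans; [apply Rabs_triang|]. rewrite Rabs_Ropp. lra.
Qed.

Lemma Cconj_RtoC (x : R) : Cconj (RtoC x) = RtoC x.
Proof. unfold Cconj, RtoC. simpl. f_equal. ring. Qed.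

(** The iteration is Newton's method for a real-linear map: the step [s] solves
    [H' s + conj (G' s) = - F], where [F = H + conj G], because conjugating this
    equation gives a 2 by 2 system for [s] and [conj s] whose determinant is the
    Jacobian. *)
Lemma newton_step_solves (H G : C -> C) (z : C) :
  jacobian H G z <> 0%R ->
  C_derive H z * (newton_step H G z - z)
  + Cconj (C_derive G z * (newton_step H G z - z)) = - harmonic H G z.
Proof.
  intros HJ.
  assert (HJC : RtoC (jacobian H G z) <> 0) by (intros E; apply HJ, RtoC_inj, E).
  assert (EJ : RtoC (jacobian H G z)
    = C_derive H z * Cconj (C_derive H z) - C_derive G z * Cconj (C_derive G z)).
  { unfold jacobian. rewrite RtoC_minus, !Cmod2_conj. reflexivity. }
  unfold newton_step.
  set (J := RtoC (jacobian H G z)) in *. set (F := harmonic H G z).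
  set (p := C_derive H z) in *. set (q := C_derive G z) in *.
  replace (z - (Cconj p * F - Cconj (q * F)) / J - z)
    with (- ((Cconj p * F - Cconj (q * F)) / J)) by ring.
  rewrite !Cmult_conj, Copp_conj, Cdiv_conj by exact HJC.
  rewrite Cminus_conj, !Cmult_conj, !Cconj_conj.
  replace (Cconj J) with J by (symmetry; apply Cconj_RtoC).
  replace (- F) with (- (F * (p * Cconj p - q * Cconj q) / J)).
  - field. exact HJC.
  - rewrite <- EJ. field. exact HJC.
Qed.

Lemma newton_step_bound (H G : C -> C) (z : C) (D m : R) :
  (0 < m)%R -> (m <= Rabs (jacobian H G z))%R ->
  (Cmod (C_derive H z) <= D)%R -> (Cmod (C_derive G z) <= D)%R ->
  (Cmod (newton_step H G z - z) <= 2 * D * Cmod (harmonic H G z) / m)%R.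
Proof.
  intros Hm HJ HD GD.
  assert (HJ0 : jacobian H G z <> 0%R).
  { intros E. rewrite E, Rabs_R0 in HJ. lra. }
  assert (HJC : RtoC (jacobian H G z) <> 0) by (intros E; apply HJ0, RtoC_inj, E).
  unfold newton_step. set (F := harmonic H G z).
  replace (z - (Cconj (C_derive H z) * F - Cconj (C_derive G z * F))
               / RtoC (jacobian H G z) - z)
    with (- ((Cconj (C_derive H z) * F - Cconj (C_derive G z * F))
               / RtoC (jacobian H G z))) by ring.
  rewrite Cmod_opp, Cmod_div, Cmod_R by exact HJC.
  pose proof (Cmod_ge_0 F). pose proof (Cmod_ge_0 (C_derive H z)).
  apply Rmult_le_compat.
  - apply Cmod_ge_0.
  - apply Rlt_le, Rinv_0_lt_compat. lra.
  - eapply Rle_trans; [apply Cmod_triangle_minus|].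
    rewrite Cmod_conj, !Cmod_mult, Cmod_conj. nra.
  - apply Rinv_le_contravar; assumption.
Qed.

(** The linear part of [F] at [z] has been cancelled by the step, so only the
    two quadratic remainders survive. *)
Lemma newton_step_residual (z0 : C) (rho K : R) (H G : C -> C) (z : C) :
  quadratic_remainder z0 rho K H -> quadratic_remainder z0 rho K G ->
  disk z0 rho z -> disk z0 rho (newton_step H G z) -> jacobian H G z <> 0%R ->
  (Cmod (harmonic H G (newton_step H G z))
     <= 2 * K * Cmod (newton_step H G z - z) ^ 2)%R.
Proof.
  intros HH HG Hz Hs HJ. pose proof (newton_step_solves H G z HJ) as E.
  set (y := newton_step H G z) in *.
  replace (harmonic H G y)
    with ((H y - H z - C_derive H z * (y - z))
          + Cconj (G y - G z - C_derive G z * (y - z))).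
  - eapply Rle_trans; [apply Cmod_triangle|]. rewrite Cmod_conj.
    pose proof (HH z y Hz Hs). pose proof (HG z y Hz Hs). lra.
  - rewrite !Cminus_conj.
    replace (harmonic H G y) with (harmonic H G y - harmonic H G z
      - (C_derive H z * (y - z) + Cconj (C_derive G z * (y - z))))
      by (rewrite E; ring).
    unfold harmonic. ring.
Qed.

Lemma geometric_limit (u : nat -> C) (B : R) :
  (forall k, (Cmod (u (S k) - u k) <= B * (1 / 2) ^ k)%R) ->
  exists w : C, filterlim u eventually (locally w) /\
                (Cmod (w - u 0%nat) <= 2 * B)%R.
Proof.
  intros Hu. destruct (ex_series_geometric (fun k => u (S k) - u k) B Hu) as [l Hl].
  exists (u 0%nat + l). split.
  - apply (filterlim_ext_loc (fun n => u 0%nat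
             + @sum_n C_NormedModule (fun k => u (S k) - u k) (Init.Nat.pred n))).
    + exists 1%nat. intros [|n] Hn; [lia|]. simpl. clear Hn.
      induction n as [|n IH].
      * rewrite sum_O. ring.
      * rewrite sum_Sn. change (@plus C_NormedModule) with Cplus.
        rewrite Cplus_assoc, IH. ring.
    + apply (filterlim_comp_2 (F := eventually) (G := locally (u 0%nat))
               (H := locally l) (I := locally (u 0%nat + l))
               (fun _ => u 0%nat) _ Cplus).
      * apply filterlim_const.
      * apply (filterlim_comp _ _ _ Init.Nat.pred _ eventually eventually);
          [|exact Hl].
        intros P [N HN]. exists (S N). intros n Hn. apply HN. lia.
      * exact (@filterlim_plus C_AbsRing C_NormedModule (u 0%nat) l).
  - replace (u 0%nat + l - u 0%nat) with l by ring.
    exact (Cmod_series_le _ _ _ Hl Hu).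
Qed.

Lemma harmonic_lipschitz (z0 : C) (rho K D : R) (H G : C -> C) (x y : C) :
  (0 <= K)%R ->
  quadratic_remainder z0 rho K H -> quadratic_remainder z0 rho K G ->
  (forall z, disk z0 rho z -> (Cmod (C_derive H z) <= D)%R) ->
  (forall z, disk z0 rho z -> (Cmod (C_derive G z) <= D)%R) ->
  disk z0 rho x -> disk z0 rho y ->
  (Cmod (harmonic H G y - harmonic H G x)
     <= (2 * D + 4 * K * rho) * Cmod (y - x))%R.
Proof.
  intros HK HH HG DH DG Hx Hy.
  assert (Hxy : (Cmod (y - x) <= 2 * rho)%R).
  { unfold disk in *. pose proof (Cmod_minus_le y z0 x).
    rewrite (Cmod_minus_sym z0 x) in H0. lra. }
  pose proof (Cmod_ge_0 (y - x)) as H0.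
  assert (Hf : forall f : C -> C, quadratic_remainder z0 rho K f ->
    (forall z, disk z0 rho z -> (Cmod (C_derive f z) <= D)%R) ->
    (Cmod (f y - f x) <= (D + 2 * K * rho) * Cmod (y - x))%R).
  { intros f Hf Df.
    replace (f y - f x) with ((f y - f x - C_derive f x * (y - x))
      + C_derive f x * (y - x)) by ring.
    eapply Rle_trans; [apply Cmod_triangle|]. rewrite Cmod_mult.
    pose proof (Hf x y Hx Hy). pose proof (Df x Hx).
    assert (K * Cmod (y - x) ^ 2 <= K * (2 * rho * Cmod (y - x)))%R.
    { apply Rmult_le_compat_l; [exact HK|]. simpl. nra. }
    nra. }
  unfold harmonic.
  replace (H y + Cconj (G y) - (H x + Cconj (G x)))
    with ((H y - H x) + Cconj (G y - G x)) by (rewrite Cminus_conj; ring).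
  eapply Rle_trans; [apply Cmod_triangle|]. rewrite Cmod_conj.
  pose proof (Hf H HH DH). pose proof (Hf G HG DG). lra.
Qed.

(** A Newton-Kantorovich theorem adapted to a nearly singular starting point:
    at distance [s] from the singular point the Jacobian is only of size
    [kappa s], but the residual is of size [M s^3]. The first step is then at
    most [E s^2], which is small compared with the distance [s] over which the
    Jacobian could degenerate; and the next residual, of order [s^4], is small
    compared with [s^3]. By induction the steps decay geometrically, the iterates
    stay within [2 E s^2] of the start, and the Jacobian never falls below half
    of its initial bound. *)
Lemma newton_converges_near (z0 : C) (rho r K D kappa M s : R)
  (H G : C -> C) (zeta0 : C) :
  let E := (4 * D * M / kappa)%R in
  (rho <= r)%R -> (0 < K)%R -> (0 < D)%R -> (0 < kappa)%R -> (0 < M)%R ->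
  (0 < s)%R ->
  quadratic_remainder z0 rho K H -> quadratic_remainder z0 rho K G ->
  (forall z, disk z0 rho z -> (Cmod (C_derive H z) <= D)%R) ->
  (forall z, disk z0 rho z -> (Cmod (C_derive G z) <= D)%R) ->
  (Cmod (zeta0 - z0) <= s)%R ->
  (kappa * s <= Rabs (jacobian H G zeta0))%R ->
  (Cmod (harmonic H G zeta0) <= M * s ^ 3)%R ->
  (s + 2 * E * s ^ 2 < rho)%R ->
  (8 * D * K * (2 * E * s) <= kappa / 2)%R ->
  (2 * K * E ^ 2 * s <= M / 2)%R ->
  exists w : C,
    disk z0 rho w /\ harmonic H G w = 0 /\
    (Cmod (w - zeta0) <= 2 * E * s ^ 2)%R /\
    newton_converges (disk z0 r) H G zeta0 w.
Proof.
  intros E. assert (HEdef : E = (4 * D * M / kappa)%R) by reflexivity. clearbody E.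
  intros Hr HK HD Hkap HM Hs HH HG DH DG Hz0 HJ0 HF0 S1 S2 S3.
  assert (HE : (0 < E)%R) by (rewrite HEdef; apply Rdiv_lt_0_compat; nra).
  assert (Hs2 : (0 < s ^ 2)%R) by (apply pow_lt, Hs).
  assert (HES : (0 < E * s ^ 2)%R) by (apply Rmult_lt_0_compat; assumption).
  set (u := newton_iter H G zeta0).
  assert (Hball : forall z, (Cmod (z - zeta0) <= 2 * E * s ^ 2)%R ->
    disk z0 rho z /\ (kappa * s / 2 <= Rabs (jacobian H G z))%R).
  { intros z Hz.
    assert (Hd : disk z0 rho z).
    { unfold disk. pose proof (Cmod_minus_le z zeta0 z0). lra. }
    assert (Hd0 : disk z0 rho zeta0) by (unfold disk; lra).
    split; [exact Hd|].
    pose proof (jacobian_lipschitz z0 rho K D H G zeta0 z HH HG DH DG Hd0 Hd) as HL.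
    assert (8 * D * K * Cmod (z - zeta0) <= kappa * s / 2)%R.
    { apply Rle_trans with (8 * D * K * (2 * E * s ^ 2))%R; [|nra].
      apply Rmult_le_compat_l; [nra|exact Hz]. }
    pose proof (Rabs_triang (jacobian H G z) (jacobian H G zeta0 - jacobian H G z)) as HT.
    replace (jacobian H G z + (jacobian H G zeta0 - jacobian H G z))%R
      with (jacobian H G zeta0) in HT by ring.
    rewrite Rabs_minus_sym in HL. lra. }
  assert (Hks : (0 < kappa * s / 2)%R) by nra.
  assert (Hstep : forall k, (Cmod (u k - zeta0) <= 2 * E * s ^ 2)%R ->
     (Cmod (harmonic H G (u k)) <= M * s ^ 3 * (1 / 2) ^ k)%R ->
     (Cmod (u (S k) - u k) <= E * s ^ 2 * (1 / 2) ^ k)%R).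
  { intros k Hk HF. destruct (Hball _ Hk) as [Hd HJ].
    change (u (S k)) with (newton_step H G (u k)).
    eapply Rle_trans; [apply (newton_step_bound H G (u k) D _ Hks HJ); auto|].
    replace (E * s ^ 2 * (1 / 2) ^ k)%R
      with (2 * D * (M * s ^ 3 * (1 / 2) ^ k) / (kappa * s / 2))%R
      by (rewrite HEdef; field; lra).
    apply Rmult_le_compat_r; [apply Rlt_le, Rinv_0_lt_compat, Hks|].
    apply Rmult_le_compat_l; [lra|exact HF]. }
  assert (Hinv : forall k,
     (Cmod (u k - zeta0) <= 2 * E * s ^ 2 * (1 - (1 / 2) ^ k))%R /\
     (Cmod (harmonic H G (u k)) <= M * s ^ 3 * (1 / 2) ^ k)%R).
  { assert (Hhalf : forall k, (0 < (1 / 2) ^ k <= 1)%R).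
    { intros k. split; [apply pow_lt; lra|].
      pose proof (pow_incr (1 / 2) 1 k ltac:(lra)) as Hp. rewrite pow1 in Hp. lra. }
    induction k as [|k [IHd IHF]].
    - change (u 0%nat) with zeta0. simpl. replace (zeta0 - zeta0) with (RtoC 0) by ring. rewrite Cmod_0. lra.
    - pose proof (Hhalf k) as Hk.
      assert (Hk' : (Cmod (u k - zeta0) <= 2 * E * s ^ 2)%R) by nra.
      pose proof (Hstep k Hk' IHF) as Hst.
      assert (Hnext : (Cmod (u (S k) - zeta0)
                       <= 2 * E * s ^ 2 * (1 - (1 / 2) ^ S k))%R).
      { pose proof (Cmod_minus_le (u (S k)) (u k) zeta0). simpl. nra. }
      split; [exact Hnext|].
      destruct (Hball _ Hk') as [Hd HJ].
      assert (HJk : jacobian H G (u k) <> 0%R).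
      { intros E0. rewrite E0, Rabs_R0 in HJ. lra. }
      assert (Hd' : disk z0 rho (u (S k))).
      { pose proof (Hhalf (S k)). apply Hball. nra. }
      eapply Rle_trans.
      + exact (newton_step_residual z0 rho K H G (u k) HH HG Hd Hd' HJk).
      + change (newton_step H G (u k)) with (u (S k)).
        apply Rle_trans with (2 * K * (E * s ^ 2 * (1 / 2) ^ k) ^ 2)%R.
        { apply Rmult_le_compat_l; [lra|]. apply pow_incr. split;
            [apply Cmod_ge_0|exact Hst]. }
        set (t := ((1 / 2) ^ k)%R) in *.
        change ((1 / 2) ^ S k)%R with (1 / 2 * t)%R.
        replace (2 * K * (E * s ^ 2 * t) ^ 2)%R
          with ((2 * K * E ^ 2 * s) * (s ^ 3 * t * t))%R by ring.
        assert (0 < s ^ 3)%R by (apply pow_lt, Hs).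
        apply Rle_trans with (M / 2 * (s ^ 3 * t * t))%R.
        { apply Rmult_le_compat_r; [|exact S3].
          apply Rmult_le_pos; [apply Rmult_le_pos|]; lra. }
        assert (s ^ 3 * t * t <= s ^ 3 * t)%R.
        { assert (0 < s ^ 3 * t)%R by (apply Rmult_lt_0_compat; lra). nra. }
        nra. }
  assert (Hin : forall k, (Cmod (u k - zeta0) <= 2 * E * s ^ 2)%R).
  { intros k. pose proof (proj1 (Hinv k)) as Hk.
    pose proof (pow_lt (1 / 2) k ltac:(lra)). nra. }
  destruct (geometric_limit u (E * s ^ 2)) as [w [Hw Hw0]].
  { intros k. apply Hstep; [apply Hin|apply Hinv]. }
  change (u 0%nat) with zeta0 in Hw0. rewrite <- Rmult_assoc in Hw0.
  destruct (Hball w Hw0) as [Hdw _].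
  exists w. split; [exact Hdw|]. split; [|split; [exact Hw0|]].
  - apply Cmod_eq_0, Rle_antisym; [|apply Cmod_ge_0].
    (* the residuals at the iterates tend to 0 and [harmonic H G] is Lipschitz *)
    set (L := (2 * D + 4 * K * rho)%R).
    apply (is_lim_seq_le (fun _ => Cmod (harmonic H G w))
      (fun k => M * s ^ 3 * (1 / 2) ^ k + L * Cmod (u k - w))%R
      (Cmod (harmonic H G w)) 0%R).
    + intros k.
      pose proof (harmonic_lipschitz z0 rho K D H G (u k) w (Rlt_le _ _ HK)
                    HH HG DH DG (proj1 (Hball _ (Hin k))) Hdw) as HL.
      rewrite Cmod_minus_sym in HL. rewrite (Cmod_minus_sym w) in HL.
      pose proof (proj2 (Hinv k)).
      pose proof (Cmod_triangle_minus (harmonic H G (u k))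
                    (harmonic H G (u k) - harmonic H G w)) as HT.
      replace (harmonic H G (u k) - (harmonic H G (u k) - harmonic H G w))
        with (harmonic H G w) in HT by ring.
      unfold L. lra.
    + apply is_lim_seq_const.
    + replace (Finite 0) with (Finite (M * s ^ 3 * 0 + L * 0)) by (f_equal; ring).
      apply is_lim_seq_plus'; apply (is_lim_seq_scal_l _ _ (Finite 0)).
      * apply is_lim_seq_geom. rewrite Rabs_pos_eq; lra.
      * rewrite <- Cmod_0. replace (RtoC 0) with (w - w) by ring.
        apply Cmod_filterlim.
        apply (filterlim_comp_2 (F := eventually) (G := locally w)
                 (H := locally (- w)) (I := locally (w - w))
                 u (fun _ => - w) Cplus).
        -- exact Hw.
        -- apply filterlim_const.
        -- exact (@filterlim_plus C_AbsRing C_NormedModule w (- w)).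
  - split; [|exact Hw]. intros k.
    change (newton_iter H G zeta0 k) with (u k).
    destruct (Hball _ (Hin k)) as [Hd HJ]. split.
    + unfold disk in *. lra.
    + intros E0. unfold jacobian in HJ. rewrite E0, Rminus_diag, Rabs_R0 in HJ. lra.
Qed.

(** * The normal form at the singular zero *)

Lemma Cmod_expi (t : R) : Cmod (expi t) = 1%R.
Proof.
  unfold expi, Cmod. cbn [fst snd].
  replace (cos t ^ 2 + sin t ^ 2)%R with 1%R.
  - apply sqrt_1.
  - pose proof (sin2_cos2 t) as H. unfold Rsqr in H. lra.
Qed.

Lemma Cconj_expi (t : R) : Cconj (expi t) = expi (- t).
Proof. unfold Cconj, expi. simpl. rewrite cos_neg, sin_neg. reflexivity. Qed.

Lemma expi_mult_opp (t : R) : expi t * expi (- t) = 1.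
Proof.
  rewrite <- Cconj_expi, <- Cmod2_conj, Cmod_expi. f_equal. ring.
Qed.

Lemma expi_double (t : R) : expi (2 * t) = expi t * expi t.
Proof.
  unfold expi, Cmult. cbn [fst snd]. rewrite cos_2a, sin_2a. f_equal; ring.
Qed.

Lemma Cmod_plus_sq (p t : C) :
  (Cmod (p + t) ^ 2 = Cmod p ^ 2 + 2 * Re (Cconj p * t) + Cmod t ^ 2)%R.
Proof.
  rewrite !Cmod2_alt, re_plus, im_plus, re_mult, re_conj, im_conj. ring.
Qed.

Lemma Cmod_sq_expansion (p q e v : C) (K rho : R) :
  (0 <= K)%R -> (Cmod v <= rho)%R -> (Cmod e <= K * Cmod v ^ 2)%R ->
  (Rabs (Cmod (p + 2 * q * v + e) ^ 2 - Cmod p ^ 2 - 4 * Re (Cconj p * q * v))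
     <= ((2 * Cmod q + K * rho) ^ 2 + 2 * Cmod p * K) * Cmod v ^ 2)%R.
Proof.
  intros HK Hv He.
  replace (p + 2 * q * v + e) with (p + (2 * q * v + e)) by ring.
  rewrite Cmod_plus_sq.
  replace (Cconj p * (2 * q * v + e))
    with (RtoC 2 * (Cconj p * q * v) + Cconj p * e) by ring.
  rewrite re_plus, re_scal_l.
  replace (Cmod p ^ 2 + 2 * (2 * Re (Cconj p * q * v) + Re (Cconj p * e))
           + Cmod (2 * q * v + e) ^ 2 - Cmod p ^ 2 - 4 * Re (Cconj p * q * v))%R
    with (Cmod (2 * q * v + e) ^ 2 + 2 * Re (Cconj p * e))%R by ring.
  pose proof (Cmod_ge_0 v) as Hv0. pose proof (Cmod_ge_0 q).
  pose proof (Cmod_ge_0 p).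
  assert (Ht : (Cmod (2 * q * v + e) <= (2 * Cmod q + K * rho) * Cmod v)%R).
  { eapply Rle_trans; [apply Cmod_triangle|].
    rewrite !Cmod_mult, Cmod_R, Rabs_pos_eq by lra.
    assert (K * Cmod v ^ 2 <= K * (rho * Cmod v))%R.
    { apply Rmult_le_compat_l; [exact HK|]. simpl. nra. }
    lra. }
  assert (Ht2 : (Cmod (2 * q * v + e) ^ 2 <= (2 * Cmod q + K * rho) ^ 2 * Cmod v ^ 2)%R).
  { rewrite <- Rpow_mult_distr. apply pow_incr. split; [apply Cmod_ge_0|exact Ht]. }
  assert (Hre : (Rabs (Re (Cconj p * e)) <= Cmod p * (K * Cmod v ^ 2))%R).
  { eapply Rle_trans; [apply re_le_Cmod|]. rewrite Cmod_mult, Cmod_conj.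
    apply Rmult_le_compat_l; assumption. }
  eapply Rle_trans; [apply Rabs_triang|].
  rewrite Rabs_mult, (Rabs_pos_eq 2) by lra.
  rewrite (Rabs_pos_eq (_ ^ 2)) by apply pow2_ge_0. lra.
Qed.

Lemma exists_small (X Y : R) :
  (0 <= X)%R -> (0 < Y)%R ->
  exists s0 : R, (0 < s0)%R /\ forall s, (0 < s < s0)%R -> (X * s < Y)%R.
Proof.
  intros HX HY. exists (Y / (X + 1))%R. split.
  - apply Rdiv_lt_0_compat; lra.
  - intros s Hs.
    assert (H : ((X + 1) * s < (X + 1) * (Y / (X + 1)))%R)
      by (apply Rmult_lt_compat_l; lra).
    replace ((X + 1) * (Y / (X + 1)))%R with Y in H by (field; lra). lra.
Qed.

(** Put [z = z0 + u exp(i theta)]. After division by [a1 exp(i theta)] the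
    equation [f = delta c] reads
    [2 Re u + A u^2 + conj (B u^2) + O(u^3) = delta ctilde], and the Jacobian is
    [4 |a1|^2 Re ((A - B) u) + O(u^2)]. Hence an exact root [u] of the quadratic
    truncation has residual [O(|u|^3)], and if moreover [Re ((A - B) u)] is
    comparable to [|u|] then the starting point [z0 + u exp(i theta)] meets the
    requirements of [newton_converges_near] with [s = |u|]. *)
Lemma newton_converges_normal_form
  (z0 : C) (r : R) (a b : nat -> C) (h g : C -> C) (theta : R)
  (A B ctilde c : C) (kappa : R) :
  (0 < r)%R -> a 0%nat = 0 -> b 0%nat = 0 ->
  power_series_on_disk a z0 r h -> power_series_on_disk b z0 r g ->
  a 1%nat <> 0 -> Cmod (a 1%nat) = Cmod (b 1%nat) ->
  b 1%nat * expi theta = Cconj (a 1%nat * expi theta) ->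
  a 2%nat * expi theta = A * a 1%nat -> b 2%nat * expi theta = B * b 1%nat ->
  c = a 1%nat * expi theta * ctilde -> (0 < kappa)%R ->
  exists s0 E : R, (0 < s0)%R /\ (0 < E)%R /\
  forall (delta : R) (u : C),
    (0 < Cmod u < s0)%R ->
    RtoC (2 * Re u) + A * u ^ 2 + Cconj (B * u ^ 2) = RtoC delta * ctilde ->
    (kappa * Cmod u <= Rabs (Re ((A - B) * u)))%R ->
    exists w : C,
      is_zero (disk z0 r) (shifted h delta c) g w /\
      (Cmod (w - (z0 + u * expi theta)) <= E * Cmod u ^ 2)%R /\
      newton_converges (disk z0 r) (shifted h delta c) g (z0 + u * expi theta) w.
Proof.
  intros Hr Ha0 Hb0 Hh Hg Ha1 Hab Hb1 HA HB Hc Hkap.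
  destruct (power_series_expansion a z0 r h Hr Hh)
    as (rho1 & K1 & Hrho1 & HK1 & QH1 & TH1).
  destruct (power_series_expansion b z0 r g Hr Hg)
    as (rho2 & K2 & Hrho2 & HK2 & QG2 & TG2).
  set (rho := Rmin rho1 rho2). set (K := Rmax K1 K2).
  assert (Hrho : (0 < rho <= r)%R).
  { unfold rho. split; [apply Rmin_pos; lra|].
    eapply Rle_trans; [apply Rmin_l|lra]. }
  assert (HK : (0 < K)%R) by (unfold K; pose proof (Rmax_l K1 K2); lra).
  assert (QH : quadratic_remainder z0 rho K h).
  { apply (quadratic_remainder_weaken z0 rho1 rho K1 K); auto;
      [apply Rmin_l|apply Rmax_l]. }
  assert (QG : quadratic_remainder z0 rho K g).
  { apply (quadratic_remainder_weaken z0 rho2 rho K2 K); auto;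
      [apply Rmin_r|apply Rmax_r]. }
  assert (TH : forall v, (Cmod v < rho)%R ->
    (Cmod (h (z0 + v)%C - (a 1%nat * v + a 2%nat * v ^ 2)) <= K * Cmod v ^ 3)%R /\
    (Cmod (C_derive h (z0 + v) - (a 1%nat + 2 * a 2%nat * v)) <= K * Cmod v ^ 2)%R).
  { intros v Hv. destruct (TH1 v) as [T0 T1].
    { pose proof (Rmin_l rho1 rho2). unfold rho in Hv. lra. }
    rewrite Ha0, Cplus_0_l in T0.
    pose proof (pow_le (Cmod v) 3 (Cmod_ge_0 v)).
    pose proof (pow_le (Cmod v) 2 (Cmod_ge_0 v)).
    pose proof (Rmax_l K1 K2). fold K in H1. split; nra. }
  assert (TG : forall v, (Cmod v < rho)%R ->
    (Cmod (g (z0 + v)%C - (b 1%nat * v + b 2%nat * v ^ 2)) <= K * Cmod v ^ 3)%R /\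
    (Cmod (C_derive g (z0 + v) - (b 1%nat + 2 * b 2%nat * v)) <= K * Cmod v ^ 2)%R).
  { intros v Hv. destruct (TG2 v) as [T0 T1].
    { pose proof (Rmin_r rho1 rho2). unfold rho in Hv. lra. }
    rewrite Hb0, Cplus_0_l in T0.
    pose proof (pow_le (Cmod v) 3 (Cmod_ge_0 v)).
    pose proof (pow_le (Cmod v) 2 (Cmod_ge_0 v)).
    pose proof (Rmax_r K1 K2). fold K in H1. split; nra. }
  clear TH1 TG2 QH1 QG2.
  (* the derivatives are bounded because they are Lipschitz on the disk *)
  assert (HD : exists D, (0 < D)%R /\
    (forall z, disk z0 rho z -> (Cmod (C_derive h z) <= D)%R) /\
    (forall z, disk z0 rho z -> (Cmod (C_derive g z) <= D)%R)).
  { assert (Hb : forall f, quadratic_remainder z0 rho K f ->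
      forall z, disk z0 rho z ->
      (Cmod (C_derive f z) <= Cmod (C_derive f z0) + 2 * K * rho)%R).
    { intros f Qf z Hz.
      assert (Hz0 : disk z0 rho z0).
      { unfold disk. replace (z0 - z0) with (RtoC 0) by ring. rewrite Cmod_0. lra. }
      pose proof (C_derive_lipschitz z0 rho K f z0 z Qf Hz0 Hz).
      pose proof (Cmod_triangle (C_derive f z - C_derive f z0) (C_derive f z0)) as HT.
      replace (C_derive f z - C_derive f z0 + C_derive f z0) with (C_derive f z)
        in HT by ring.
      assert (2 * K * Cmod (z - z0) <= 2 * K * rho)%R.
      { apply Rmult_le_compat_l; [lra|]. unfold disk in Hz. lra. }
      lra. }
    exists (Cmod (C_derive h z0) + Cmod (C_derive g z0) + 2 * K * rho)%R.
    pose proof (Cmod_ge_0 (C_derive h z0)). pose proof (Cmod_ge_0 (C_derive g z0)).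
    split; [nra|]. split; intros z Hz.
    - pose proof (Hb h QH z Hz). lra.
    - pose proof (Hb g QG z Hz). lra. }
  destruct HD as (D & HD & DH & DG).
  set (Aa := Cmod (a 1%nat)) in *.
  assert (HAa : (0 < Aa)%R) by (apply Cmod_gt_0, Ha1).
  set (La := ((2 * Cmod (a 2%nat) + K * rho) ^ 2 + 2 * Aa * K)%R).
  set (Lb := ((2 * Cmod (b 2%nat) + K * rho) ^ 2 + 2 * Cmod (b 1%nat) * K)%R).
  set (kap := (2 * Aa ^ 2 * kappa)%R).
  assert (Hkap' : (0 < kap)%R).
  { unfold kap. pose proof (pow_lt Aa 2 HAa). nra. }
  set (E := (4 * D * (2 * K) / kap)%R).
  assert (HE : (0 < E)%R) by (unfold E; apply Rdiv_lt_0_compat; nra).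
  assert (HL : (0 <= La + Lb)%R).
  { unfold La, Lb. pose proof (pow2_ge_0 (2 * Cmod (a 2%nat) + K * rho)).
    pose proof (pow2_ge_0 (2 * Cmod (b 2%nat) + K * rho)).
    pose proof (Cmod_ge_0 (b 1%nat)).
    assert (0 <= Aa * K)%R by nra. assert (0 <= Cmod (b 1%nat) * K)%R by nra. lra. }
  destruct (exists_small (1 + 2 * E) rho) as (s1 & Hs1 & S1); [lra|lra|].
  destruct (exists_small (16 * D * K * E) (kap / 2)) as (s2 & Hs2 & S2); [|lra|].
  { assert (0 < D * K)%R by nra. nra. }
  destruct (exists_small (2 * K * E ^ 2) K) as (s3 & Hs3 & S3); [|lra|].
  { pose proof (pow2_ge_0 E). nra. }
  destruct (exists_small (La + Lb) kap) as (s4 & Hs4 & S4); [exact HL|exact Hkap'|].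
  exists (Rmin (Rmin (Rmin s1 s2) (Rmin s3 s4)) 1), (2 * E)%R.
  split; [repeat apply Rmin_pos; lra|]. split; [lra|].
  intros delta u [Hu0 Hu] Hnf Hk.
  apply Rmin_Rgt_l in Hu as [Hu Hu1].
  apply Rmin_Rgt_l in Hu as [Hu12 Hu34].
  apply Rmin_Rgt_l in Hu12 as [Hu_1 Hu_2]. apply Rmin_Rgt_l in Hu34 as [Hu_3 Hu_4].
  specialize (S1 (Cmod u) (conj Hu0 Hu_1)). specialize (S2 (Cmod u) (conj Hu0 Hu_2)).
  specialize (S3 (Cmod u) (conj Hu0 Hu_3)). specialize (S4 (Cmod u) (conj Hu0 Hu_4)).
  clear Hu_1 Hu_2 Hu_3 Hu_4.
  set (e := expi theta) in *. set (v := u * e).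
  assert (Hv : Cmod v = Cmod u).
  { unfold v, e. rewrite Cmod_mult, Cmod_expi. ring. }
  set (s := Cmod u) in *.
  assert (Hss : (s ^ 2 <= s)%R) by (clear - Hu0 Hu1; simpl; nra).
  assert (HEs : (0 <= E * s ^ 2 <= E * s)%R).
  { split; [apply Rmult_le_pos; [lra|apply pow2_ge_0]|].
    apply Rmult_le_compat_l; lra. }
  assert (Hs2E : (s + 2 * E * s ^ 2 < rho)%R) by lra.
  assert (Hvrho : (Cmod v < rho)%R) by lra.
  destruct (TH v Hvrho) as [TH0 TH1]. destruct (TG v Hvrho) as [TG0 TG1].
  rewrite Hv in TH0, TH1, TG0, TG1.
  assert (Hdv : disk z0 rho (z0 + v)).
  { unfold disk. replace (z0 + v - z0) with v by ring. exact Hvrho. }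
  assert (HF : (Cmod (harmonic (shifted h delta c) g (z0 + v)) <= 2 * K * s ^ 3)%R).
  { replace (harmonic (shifted h delta c) g (z0 + v))
      with ((h (z0 + v) - (a 1%nat * v + a 2%nat * v ^ 2))
            + Cconj (g (z0 + v) - (b 1%nat * v + b 2%nat * v ^ 2))).
    { eapply Rle_trans; [apply Cmod_triangle|]. rewrite Cmod_conj. lra. }
    (* the truncation vanishes exactly, by the equation imposed on [u] *)
    assert (Hlow : a 1%nat * v + a 2%nat * v ^ 2
                   + Cconj (b 1%nat * v + b 2%nat * v ^ 2) = RtoC delta * c).
    { replace (a 1%nat * v + a 2%nat * v ^ 2)
        with (a 1%nat * e * (u + A * u ^ 2)).
      2:{ unfold v. transitivity (a 1%nat * (u * e) + (a 2%nat * e) * e * u ^ 2);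
            [rewrite HA|]; simpl; ring. }
      replace (b 1%nat * v + b 2%nat * v ^ 2)
        with (b 1%nat * e * (u + B * u ^ 2)).
      2:{ unfold v. transitivity (b 1%nat * (u * e) + (b 2%nat * e) * e * u ^ 2);
            [rewrite HB|]; simpl; ring. }
      rewrite Hb1, Cmult_conj, Cconj_conj, Cplus_conj, Hc.
      replace (RtoC delta * (a 1%nat * e * ctilde))
        with (a 1%nat * e * (RtoC delta * ctilde)) by ring.
      rewrite <- Hnf.
      replace (RtoC (2 * Re u)) with (u + Cconj u); [ring|].
      unfold Cconj, RtoC, Cplus, Re. simpl. f_equal; ring. }
    unfold harmonic, shifted. rewrite Cminus_conj.
    rewrite <- Hlow. ring. }
  assert (HJ : (kap * s <= Rabs (jacobian (shifted h delta c) g (z0 + v)))%R).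
  { unfold jacobian. rewrite (C_derive_shifted z0 rho K delta c (z0 + v) h QH Hdv).
    pose proof (Cmod_sq_expansion (a 1%nat) (a 2%nat)
      (C_derive h (z0 + v) - (a 1%nat + 2 * a 2%nat * v)) v K rho (Rlt_le _ _ HK)
      ltac:(lra) ltac:(rewrite Hv; exact TH1)) as JH.
    pose proof (Cmod_sq_expansion (b 1%nat) (b 2%nat)
      (C_derive g (z0 + v) - (b 1%nat + 2 * b 2%nat * v)) v K rho (Rlt_le _ _ HK)
      ltac:(lra) ltac:(rewrite Hv; exact TG1)) as JG.
    rewrite Hv in JH, JG. fold Aa La in JH. fold Lb in JG.
    replace (a 1%nat + 2 * a 2%nat * v
             + (C_derive h (z0 + v) - (a 1%nat + 2 * a 2%nat * v)))
      with (C_derive h (z0 + v)) in JH by ring.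
    replace (b 1%nat + 2 * b 2%nat * v
             + (C_derive g (z0 + v) - (b 1%nat + 2 * b 2%nat * v)))
      with (C_derive g (z0 + v)) in JG by ring.
    replace (Cconj (a 1%nat) * a 2%nat * v) with (RtoC (Aa ^ 2) * (A * u)) in JH.
    2:{ unfold Aa. rewrite Cmod2_conj. unfold v.
        transitivity (Cconj (a 1%nat) * (a 2%nat * e) * u); [rewrite HA|]; ring. }
    replace (Cconj (b 1%nat) * b 2%nat * v) with (RtoC (Aa ^ 2) * (B * u)) in JG.
    2:{ rewrite Hab, Cmod2_conj. unfold v.
        transitivity (Cconj (b 1%nat) * (b 2%nat * e) * u); [rewrite HB|]; ring. }
    rewrite re_scal_l in JH, JG. rewrite <- Hab in JG.
    replace ((A - B) * u) with (A * u - B * u) in Hk by ring.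
    assert (Hre : (Re (A * u - B * u) = Re (A * u) - Re (B * u))%R) by reflexivity.
    rewrite Hre in Hk.
    set (X := (Cmod (C_derive h (z0 + v)) ^ 2)%R) in *.
    set (Y := (Cmod (C_derive g (z0 + v)) ^ 2)%R) in *.
    set (x := Re (A * u)) in *. set (y := Re (B * u)) in *.
    assert (HAa2 : (0 < Aa ^ 2)%R) by (apply pow_lt, HAa).
    assert (Hmain : (2 * kap * s <= Rabs (4 * Aa ^ 2 * (x - y)))%R).
    { rewrite Rabs_mult, (Rabs_pos_eq (4 * Aa ^ 2)) by lra.
      unfold kap. nra. }
    pose proof (Rabs_triang (X - Y)
      (- (X - Aa ^ 2 - 4 * (Aa ^ 2 * x)) + (Y - Aa ^ 2 - 4 * (Aa ^ 2 * y)))) as T1.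
    pose proof (Rabs_triang (- (X - Aa ^ 2 - 4 * (Aa ^ 2 * x)))
      (Y - Aa ^ 2 - 4 * (Aa ^ 2 * y))) as T2.
    replace (X - Y + (- (X - Aa ^ 2 - 4 * (Aa ^ 2 * x))
             + (Y - Aa ^ 2 - 4 * (Aa ^ 2 * y))))%R
      with (4 * Aa ^ 2 * (x - y))%R in T1 by ring.
    rewrite Rabs_Ropp in T2.
    assert ((La + Lb) * s ^ 2 <= kap * s)%R by (simpl; nra).
    lra. }
  destruct (newton_converges_near z0 rho r K D kap (2 * K) s
              (shifted h delta c) g (z0 + v)) as (w & Hw1 & Hw2 & Hw3 & Hw4);
    try assumption; try lra.
  - apply quadratic_remainder_shifted, QH.
  - intros z Hz. rewrite (C_derive_shifted z0 rho K delta c z h QH Hz). auto.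
  - replace (z0 + v - z0) with v by ring. lra.
  - fold E. lra.
  - fold E. lra.
  - exists w. split; [split; [|exact Hw2]|split; [exact Hw3|exact Hw4]].
    unfold disk in *. lra.
Qed.

(** * Zeros near the singular zero *)

Theorem theorem5p2
  (z0 : C) (r : R) (a b : nat -> C) (h g : C -> C)
  (theta : R) (ctilde c : C)
  (hr : (0 < r)%R)
  (ha0 : a 0%nat = RtoC 0)
  (hb0 : b 0%nat = RtoC 0)
  (hh : power_series_on_disk a z0 r h)
  (hg : power_series_on_disk b z0 r g)
  (hsing : singular_zero (disk z0 r) h g z0)
  (hab : Cmod (a 1%nat) = Cmod (b 1%nat))
  (hb1 : Cmod (b 1%nat) <> 0%R)
  (htheta : (0 <= theta < PI)%R)
  (htheta_def : Cconj (b 1%nat) = a 1%nat * expi (2 * theta))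
  (hctilde : ctilde = - (a 2%nat / a 1%nat) * expi theta
                      - Cconj (b 2%nat / b 1%nat * expi theta))
  (hc : c = Cconj (b 1%nat) * expi (- theta) * ctilde) :
  (Im ctilde <> 0%R ->
   forall eps : R, (0 < eps)%R ->
   exists delta0 : R, (0 < delta0)%R /\
   forall delta : R, (0 < delta < delta0)%R ->
   exists w_plus w_minus : C,
     w_plus <> w_minus /\
     is_zero (disk z0 r) (shifted h delta c) g w_plus /\
     is_zero (disk z0 r) (shifted h delta c) g w_minus /\
     disk z0 eps w_plus /\
     disk z0 eps w_minus /\
     newton_converges (disk z0 r) (shifted h delta c) g
       (z0 + Ci * RtoC (sqrt delta) * expi theta) w_plus /\
     newton_converges (disk z0 r) (shifted h delta c) g
       (z0 - Ci * RtoC (sqrt delta) * expi theta) w_minus)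
  /\
  (Im ctilde = 0%R ->
   Cmod (a 2%nat) <> Cmod (b 2%nat) ->
   exists delta0 : R, (0 < delta0)%R /\
   forall delta : R, delta <> 0%R -> (Rabs delta < delta0)%R ->
   exists w : C,
     is_zero (disk z0 r) (shifted h delta c) g w /\
     newton_converges (disk z0 r) (shifted h delta c) g
       (z0 + RtoC (1 - sqrt (1 - delta * Re ctilde ^ 2)) / ctilde * expi theta)
       w).
Proof.
  assert (Hb1 : b 1%nat <> 0) by (intros E; apply hb1; rewrite E; apply Cmod_0).
  assert (Ha1 : a 1%nat <> 0).
  { intros E. apply hb1. rewrite <- hab, E. apply Cmod_0. }
  assert (Hbar : Cconj (b 1%nat) * expi (- theta) = a 1%nat * expi theta).
  { rewrite htheta_def, expi_double.
    transitivity (a 1%nat * expi theta * (expi theta * expi (- theta))); [ring|].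
    rewrite expi_mult_opp. ring. }
  assert (Hbe : b 1%nat * expi theta = Cconj (a 1%nat * expi theta)).
  { rewrite <- Hbar, Cmult_conj, Cconj_conj, Cconj_expi, Ropp_involutive.
    reflexivity. }
  set (A := a 2%nat / a 1%nat * expi theta) in *.
  set (B := b 2%nat / b 1%nat * expi theta) in *.
  assert (HA : a 2%nat * expi theta = A * a 1%nat) by (unfold A; field; exact Ha1).
  assert (HB : b 2%nat * expi theta = B * b 1%nat) by (unfold B; field; exact Hb1).
  assert (Hct : ctilde = - A - Cconj B) by (rewrite hctilde; unfold A; ring).
  rewrite Hbar in hc. clear hctilde Hbar.
  pose proof (fun kappa => newton_converges_normal_form z0 r a b h g theta A B
    ctilde c kappa hr ha0 hb0 hh hg Ha1 hab Hbe HA HB hc) as Hnewton.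
  assert (Him : Im ctilde = (Im B - Im A)%R).
  { rewrite Hct. unfold Im. simpl. ring. }
  assert (Hre : Re ctilde = (- (Re A + Re B))%R).
  { rewrite Hct. unfold Re. simpl. ring. }
  split.
  - intros Hc eps Heps.
    destruct (Hnewton (Rabs (Im ctilde)) (Rabs_pos_lt _ Hc))
      as (s0 & E & Hs0 & HE & Hw).
    destruct (exists_small (1 + E) eps) as (s1 & Hs1 & S1); [lra|lra|].
    destruct (exists_small E 1) as (s2 & Hs2 & S2); [lra|lra|].
    set (m := Rmin (Rmin s0 1) (Rmin s1 s2)).
    assert (Hm : (0 < m)%R) by (unfold m; repeat apply Rmin_pos; lra).
    (* the smallness conditions bear on [sqrt delta], hence the square *)
    exists (m ^ 2)%R. split; [apply pow_lt, Hm|].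
    intros delta Hdelta. set (t := sqrt delta).
    assert (Ht0 : (0 < t)%R) by (apply sqrt_lt_R0; lra).
    assert (Htm : (t < m)%R).
    { unfold t. rewrite <- (sqrt_pow2 m) by lra. apply sqrt_lt_1_alt. lra. }
    assert (Htt : (t * t = delta)%R) by (apply sqrt_sqrt; lra).
    unfold m in Htm. apply Rmin_Rgt_l in Htm as [Htm1 Htm2].
    apply Rmin_Rgt_l in Htm1 as [Hts0 Ht1]. apply Rmin_Rgt_l in Htm2 as [Hts1 Hts2].
    specialize (S1 t (conj Ht0 Hts1)). specialize (S2 t (conj Ht0 Hts2)).
    assert (HEt : (E * t ^ 2 <= E * t)%R).
    { apply Rmult_le_compat_l; [lra|]. clear - Ht0 Ht1. simpl. nra. }
    assert (HEt' : (E * t ^ 2 < t)%R) by (clear - Ht0 S2; simpl; nra).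
    (* [u = sg i t] has [u^2 = - delta] and no real part, and [A + conj B] is
       [- ctilde], so it solves the truncated equation; [sg] is the sign *)
    assert (Hsol : forall sg : R, (sg * sg = 1)%R ->
      exists w : C,
        is_zero (disk z0 r) (shifted h delta c) g w /\
        (Cmod (w - (z0 + Ci * RtoC (sg * t) * expi theta)) <= E * t ^ 2)%R /\
        newton_converges (disk z0 r) (shifted h delta c) g
          (z0 + Ci * RtoC (sg * t) * expi theta) w).
    { intros sg Hsg.
      assert (Hsg1 : Rabs sg = 1%R).
      { pose proof (Rabs_pos sg). pose proof (Rabs_mult sg sg) as Hm2.
        rewrite Hsg, Rabs_R1 in Hm2. nra. }
      assert (Hu : Cmod (Ci * RtoC (sg * t)) = t).
      { rewrite Cmod_mult, Cmod_Ci, Cmod_R, Rabs_mult, Hsg1, Rabs_pos_eq; lra. }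
      destruct (Hw delta (Ci * RtoC (sg * t))) as (w & W1 & W2 & W3).
      - rewrite Hu. split; assumption.
      - replace (Re (Ci * RtoC (sg * t))) with 0%R by (unfold Re; simpl; ring).
        replace ((Ci * RtoC (sg * t)) ^ 2) with (RtoC (- delta)).
        2:{ rewrite <- Htt. unfold Ci, RtoC. simpl. unfold Cmult. simpl. f_equal; [|ring].
            transitivity (- (sg * sg * (t * t)))%R; [rewrite Hsg|]; ring. }
        rewrite Cmult_conj, Cconj_RtoC, Hct, Rmult_0_r, RtoC_opp. ring.
      - rewrite Hu.
        replace (Re ((A - B) * (Ci * RtoC (sg * t))))
          with (sg * (Im ctilde * t))%R by (rewrite Him; unfold Re, Im; simpl; ring).
        rewrite !Rabs_mult, Hsg1, (Rabs_pos_eq t); lra.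
      - rewrite Hu in W2. exists w. split; [exact W1|]. split; [exact W2|exact W3]. }
    destruct (Hsol 1%R) as (wp & P1 & P2 & P3); [ring|].
    destruct (Hsol (-1)%R) as (wm & M1 & M2 & M3); [ring|].
    assert (Hnear : forall sg w, Rabs sg = 1%R ->
      (Cmod (w - (z0 + Ci * RtoC (sg * t) * expi theta)) <= E * t ^ 2)%R ->
      disk z0 eps w).
    { intros sg w Hsg Hwt. unfold disk.
      pose proof (Cmod_minus_le w (z0 + Ci * RtoC (sg * t) * expi theta) z0) as HT.
      replace (z0 + Ci * RtoC (sg * t) * expi theta - z0)
        with (Ci * RtoC (sg * t) * expi theta) in HT by ring.
      rewrite !Cmod_mult, Cmod_Ci, Cmod_R, Cmod_expi, Rabs_mult, Hsg in HT.
      rewrite (Rabs_pos_eq t) in HT by lra. lra. }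
    assert (Hneg : z0 + Ci * RtoC (-1 * t) * expi theta
                   = z0 - Ci * RtoC t * expi theta) by (rewrite RtoC_mult; ring).
    exists wp, wm. split; [|split; [exact P1|split; [exact M1|split; [|split; [|split]]]]].
    (* the starting points are [2 t] apart, and each zero is within [E t^2 < t] *)
    + intros Heq. subst wm.
      pose proof (Cmod_triangle_minus
        (wp - (z0 + Ci * RtoC (-1 * t) * expi theta))
        (wp - (z0 + Ci * RtoC (1 * t) * expi theta))) as HT.
      replace (wp - (z0 + Ci * RtoC (-1 * t) * expi theta)
               - (wp - (z0 + Ci * RtoC (1 * t) * expi theta)))
        with (Ci * RtoC (2 * t) * expi theta) in HT
        by (rewrite !RtoC_mult; ring).
      rewrite !Cmod_mult, Cmod_Ci, Cmod_R, Cmod_expi, Rabs_pos_eq in HT by lra.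
      lra.
    + apply (Hnear 1%R); [apply Rabs_R1|exact P2].
    + apply (Hnear (-1)%R); [rewrite Rabs_left; lra|exact M2].
    + rewrite Rmult_1_l in P3. exact P3.
    + rewrite <- Hneg. exact M3.
  - intros Hc Hab2.
    assert (HABi : Im A = Im B) by lra.
    assert (HABm : Cmod A <> Cmod B).
    { unfold A, B. intros E.
      rewrite !Cmod_mult, !Cmod_div, Cmod_expi, hab in E by assumption.
      apply Hab2. apply (Rmult_eq_reg_r (/ Cmod (b 1%nat)));
        [|apply Rinv_neq_0_compat, hb1].
      unfold Rdiv in E. lra. }
    (* as [Im A = Im B], this product is [|A|^2 - |B|^2]; its factors are
       [- ctilde] and the coefficient of the Jacobian along real [u] *)
    assert (HABr : ((Re A + Re B) * (Re A - Re B) <> 0)%R).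
    { intros E. apply HABm.
      assert (E2 : (Cmod A ^ 2 = Cmod B ^ 2)%R).
      { rewrite !Cmod2_alt, HABi. lra. }
      rewrite <- (sqrt_pow2 (Cmod A)), <- (sqrt_pow2 (Cmod B)) by apply Cmod_ge_0.
      rewrite E2. reflexivity. }
    set (k := Re ctilde) in *.
    assert (Hk : k <> 0%R).
    { intros E. apply HABr. replace (Re A + Re B)%R with 0%R by lra. ring. }
    assert (Hd : (Re A - Re B <> 0)%R) by (intros E; apply HABr; rewrite E; ring).
    assert (Hck : ctilde = RtoC k).
    { unfold k, RtoC. rewrite (surjective_pairing ctilde) at 1.
      f_equal. exact Hc. }
    destruct (Hnewton (Rabs (Re A - Re B)) (Rabs_pos_lt _ Hd))
      as (s0 & E & Hs0 & HE & Hw).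
    assert (Hk2 : (0 < k ^ 2)%R) by (apply pow2_gt_0, Hk).
    destruct (exists_small (k ^ 2) 1) as (d1 & Hd1 & D1); [lra|lra|].
    destruct (exists_small (Rabs k) s0) as (d2 & Hd2 & D2); [apply Rabs_pos|lra|].
    exists (Rmin d1 d2). split; [apply Rmin_pos; lra|].
    intros delta Hdelta Hlt.
    assert (Hpos := Rabs_pos_lt _ Hdelta).
    apply Rmin_Rgt_l in Hlt as [Hlt1 Hlt2].
    specialize (D1 _ (conj Hpos Hlt1)). specialize (D2 _ (conj Hpos Hlt2)).
    assert (Hrad : (0 <= 1 - delta * k ^ 2)%R).
    { pose proof (Rmult_le_compat_r (k ^ 2) _ _ (Rlt_le _ _ Hk2) (Rle_abs delta)).
      lra. }
    set (y := sqrt (1 - delta * k ^ 2)).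
    assert (Hy0 : (0 <= y)%R) by apply sqrt_pos.
    assert (Hyy : (y * y = 1 - delta * k ^ 2)%R) by (apply sqrt_sqrt, Hrad).
    set (x := ((1 - y) / k)%R).
    assert (Hxk : (x * k = 1 - y)%R) by (unfold x; field; exact Hk).
    (* rationalised form of the root [x] *)
    assert (Hxy : (x * (1 + y) = delta * k)%R).
    { apply (Rmult_eq_reg_r k); [|exact Hk].
      replace (x * (1 + y) * k)%R with ((x * k) * (1 + y))%R by ring.
      rewrite Hxk. simpl in Hyy. lra. }
    assert (Hx0 : x <> 0%R).
    { intros E0. rewrite E0, Rmult_0_l in Hxy. symmetry in Hxy.
      apply Rmult_integral in Hxy. tauto. }
    assert (Hxs : (Rabs x < s0)%R).
    { assert (Hle : (Rabs x <= Rabs (x * (1 + y)))%R).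
      { rewrite Rabs_mult, (Rabs_pos_eq (1 + y)) by lra.
        pose proof (Rabs_pos x). nra. }
      rewrite Hxy, Rabs_mult in Hle. lra. }
    assert (Hu : RtoC (1 - y) / ctilde = RtoC x).
    { rewrite Hck. unfold x. rewrite RtoC_div by exact Hk. reflexivity. }
    rewrite Hu.
    destruct (Hw delta (RtoC x)) as (w & W1 & _ & W3).
    + rewrite Cmod_R. split; [apply Rabs_pos_lt, Hx0|exact Hxs].
    + assert (HAB : A + Cconj B = - RtoC k) by (rewrite <- Hck, Hct; ring).
      rewrite re_RtoC, Cmult_conj, <- RtoC_pow, Cconj_RtoC, Hck.
      transitivity (RtoC (2 * x) + (A + Cconj B) * RtoC (x ^ 2)); [ring|].
      rewrite HAB, <- RtoC_opp, <- !RtoC_mult, <- RtoC_plus. f_equal.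
      (* [x] is a root of k x^2 - 2 x + delta k *)
      replace (2 * x + - k * x ^ 2)%R with (x * (2 - x * k))%R by ring.
      rewrite Hxk, <- Hxy. ring.
    + rewrite re_scal_r, Cmod_R, Rabs_mult. right. reflexivity.
    + exists w. split; [exact W1|exact W3].
Qed.
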